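(* Let $\Omega\subset\mathbb{R}^d$ be a nonempty compact convex set, let $m\ge1$, and let $f=\frac1m\sum_{i=1}^m f^i$, where each $f^i:\mathbb{R}^d\to\mathbb{R}$ is convex and $L$-smooth on $\mathbb{R}^d$. Let $x^*\in\operatorname{argmin}_{x\in\Omega}f(x)$. Let $(x_k)_{k\ge0}$ be generated by the Incremental Frank-Wolfe algorithm (described in the context) with step sizes $\alpha_k=\frac{2}{k+1}$. Then $$f(x_k)-f(x^* )=\mathcal{O}\Big(\frac1k\Big),$$ i.e. there is a constant $C$ independent of $k$ such that $f(x_k)-f(x^* )\le C/k$ for all $k\ge1$.
   Context: $\|\cdot\|$ is the Euclidean norm and $\langle\cdot,\cdot\rangle$ the Euclidean inner product. A function $h$ is $L$-smooth if it is differentiable and $\|\nabla h(x)-\nabla h(y)\|\le L\|x-y\|$ for all $x,y\in\mathbb{R}^d$. For an integer $k\ge0$, $[k]_m:=(k\bmod m)+1\in\{1,\dots,m\}$. Incremental Frank-Wolfe algorithm (cyclic order). Input: $x_0\in\Omega$ and step sizes $\alpha_k$. The aggregated gradient is initialized to zero before the loop: $d_{-1}=0$. For $k=0,1,2,\dots$: 1. Compute the gradient $\nabla f^{[k]_m}(x_k)$. 2. Update $d_k=\frac1m\Big\{m\,d_{k-1}-\nabla f^{[k]_m}(x_{k-m})+\nabla f^{[k]_m}(x_k)\Big\}$, where the term $\nabla f^{[k]_m}(x_{k-m})$ is taken to be $0$ when $k<m$. (Thus $d_k=\frac1m\sum_{i=\max(0,k-m+1)}^{k}\nabla f^{[i]_m}(x_i)$.)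 3. Choose $w_k\in\operatorname{argmin}_{x\in\Omega}\langle d_k,x\rangle$ (any minimizer). 4. $x_{k+1}=(1-\alpha_k)x_k+\alpha_k w_k$. *)

(* Defs.v *)
From HB Require Import structures.
From mathcomp Require Import all_boot all_order all_algebra.
From mathcomp Require Import all_classical all_reals all_analysis.

Set Implicit Arguments.
Unset Strict Implicit.
Unset Printing Implicit Defensive.

Import Order.TTheory GRing.Theory Num.Theory.
Import numFieldNormedType.Exports.

Local Open Scope classical_set_scope.
Local Open Scope ring_scope.

Definition dotp (R : realType) (d : nat) (u v : 'rV[R]_d) : R :=
  \sum_(i < d) u ord0 i * v ord0 i.

(* The library norm `|u| on 'rV[R]_d is the sup norm; it is used below only
   through the topology (compact, differentiable), which is the Euclidean one. *)
Definition enorm (R : realType) (d : nat) (u : 'rV[R]_d) : R :=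
  Num.sqrt (dotp u u).

Definition grad (R : realType) (d : nat) (h : 'rV[R]_d -> R) (x : 'rV[R]_d) :
    'rV[R]_d :=
  \row_(i < d) 'D_(delta_mx ord0 i) h x.

Definition smooth (R : realType) (d : nat) (L : R) (h : 'rV[R]_d -> R) : Prop :=
  (forall x, differentiable h x) /\
  (forall x y, enorm (grad h x - grad h y) <= L * enorm (x - y)).

Definition argmin (R : realType) (T : Type) (A : set T) (g : T -> R) : set T :=
  [set x | A x /\ forall y, A y -> g x <= g y].

Definition average (R : realType) (d m : nat) (f : 'I_m -> 'rV[R]_d -> R)
    (x : 'rV[R]_d) : R :=
  m%:R^-1 * \sum_(i < m) f i x.

(* Components are numbered from 0, so the 1-based index (k mod m) + 1 is the
   ordinal k mod m. *)
Definition cyclic_index (m : nat) (m_gt0 : (0 < m)%N) (k : nat) : 'I_m :=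
  Ordinal (ltn_pmod k m_gt0).

(* The term d_{k-1}, with d_{-1} = 0. *)
Definition prev (R : realType) (d : nat) (D : nat -> 'rV[R]_d) (k : nat) :
    'rV[R]_d :=
  if k is k'.+1 then D k' else 0.

(* (x, D, w) are the iterates, aggregated gradients and linear minimizers of
   some execution: the choice of each w k among the minimizers is free. *)
Record incremental_FW (R : realType) (d m : nat) (m_gt0 : (0 < m)%N)
    (Omega : set 'rV[R]_d) (f : 'I_m -> 'rV[R]_d -> R) (alpha : nat -> R)
    (x D w : nat -> 'rV[R]_d) : Prop := {
  ifw_init : Omega (x 0%N) ;
  ifw_grad : forall k,
    let g := grad (f (cyclic_index m_gt0 k)) in
    D k = m%:R^-1 *:
      (m%:R *: prev D k - (if (k < m)%N then 0 else g (x (k - m)%N)) + g (x k)) ;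
  ifw_lmo : forall k, argmin Omega (dotp (D k)) (w k) ;
  ifw_step : forall k, x k.+1 = (1 - alpha k) *: x k + alpha k *: w k
}.

(* Main.v *)
(** With [h k = f (x k) - f xstar] and [alpha k = 2 / (k + 1)]: once [m <= k + 1],
    [D k] is the average of the gradients of the [f i], each evaluated at one of
    the last [m] iterates.  These iterates are at distance [O(1 / k)] from [x k],
    so [D k] is within [O(1 / k)] of the gradient of [f] at [x k], and the
    Frank-Wolfe step gives
    [h (k + 1) <= (1 - 2 / (k + 1)) * h k + K / (k + 1) ^ 2], hence
    [h k = O(1 / k)].  As [alpha 0 = 2], [x 1] may lie outside [Omega]; only the
    boundedness of the iterates is used, and [h] need not be nonnegative. *)
Require Import Defs.
From HB Require Import structures.
From mathcomp Require Import all_boot all_order all_algebra.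
From mathcomp Require Import all_classical all_reals all_analysis.
From mathcomp Require Import ring lra zify.
Import Order.TTheory GRing.Theory Num.Theory.
Import numFieldNormedType.Exports.
Local Open Scope classical_set_scope.
Local Open Scope ring_scope.

Set Implicit Arguments.
Unset Strict Implicit.

(** * Euclidean inner product and norm *)

Lemma dotpC (R : realType) (d : nat) (u v : 'rV[R]_d) : dotp u v = dotp v u.
Proof. by apply: eq_bigr => i _; rewrite mulrC. Qed.

Lemma dotpDl (R : realType) (d : nat) (u v w : 'rV[R]_d) :
  dotp (u + v) w = dotp u w + dotp v w.
Proof. by rewrite -big_split; apply: eq_bigr => i _; rewrite mxE mulrDl. Qed.

Lemma dotpZl (R : realType) (d : nat) (a : R) (u v : 'rV[R]_d) :
  dotp (a *: u) v = a * dotp u v.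
Proof. by rewrite /dotp mulr_sumr; apply: eq_bigr => i _; rewrite mxE mulrA. Qed.

Lemma dotpNl (R : realType) (d : nat) (u v : 'rV[R]_d) :
  dotp (- u) v = - dotp u v.
Proof. by rewrite -scaleN1r dotpZl mulN1r. Qed.

Lemma dotpDr (R : realType) (d : nat) (u v w : 'rV[R]_d) :
  dotp u (v + w) = dotp u v + dotp u w.
Proof. by rewrite dotpC dotpDl !(dotpC u). Qed.

Lemma dotpZr (R : realType) (d : nat) (a : R) (u v : 'rV[R]_d) :
  dotp u (a *: v) = a * dotp u v.
Proof. by rewrite dotpC dotpZl dotpC. Qed.

Lemma dotpNr (R : realType) (d : nat) (u v : 'rV[R]_d) :
  dotp u (- v) = - dotp u v.
Proof. by rewrite dotpC dotpNl dotpC. Qed.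

Lemma dotp_suml (R : realType) (d : nat) (I : Type) (s : seq I) (P : pred I)
    (F : I -> 'rV[R]_d) (v : 'rV[R]_d) :
  dotp (\sum_(i <- s | P i) F i) v = \sum_(i <- s | P i) dotp (F i) v.
Proof.
apply: (big_morph (fun u => dotp u v)) => [u w|]; first exact: dotpDl.
by rewrite -(scale0r 0) dotpZl mul0r.
Qed.

Lemma enorm_ge0 (R : realType) (d : nat) (u : 'rV[R]_d) : 0 <= enorm u.
Proof. exact: sqrtr_ge0. Qed.

Lemma dotp_ge0 (R : realType) (d : nat) (u : 'rV[R]_d) : 0 <= dotp u u.
Proof. by apply: sumr_ge0 => i _; rewrite -expr2 sqr_ge0. Qed.

Lemma sqr_enorm (R : realType) (d : nat) (u : 'rV[R]_d) :
  enorm u ^+ 2 = dotp u u.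
Proof. by rewrite sqr_sqrtr// dotp_ge0. Qed.

Lemma enorm_eq0 (R : realType) (d : nat) (u : 'rV[R]_d) : enorm u = 0 -> u = 0.
Proof.
move=> u0; have := sqr_enorm u; rewrite u0 expr0n /= => /esym/eqP.
rewrite psumr_eq0 => [|i _]; last by rewrite -expr2 sqr_ge0.
move=> /allP uu0; apply/rowP => i; rewrite mxE.
by have := uu0 i (mem_index_enum _); rewrite -expr2 sqrf_eq0 => /eqP.
Qed.

Lemma dotp_le_enorm (R : realType) (d : nat) (u v : 'rV[R]_d) :
  dotp u v <= enorm u * enorm v.
Proof.
have [u0|u0] := eqVneq (enorm u) 0.
  by rewrite u0 (enorm_eq0 u0) -(scale0r 0) dotpZl !mul0r.
have [v0|v0] := eqVneq (enorm v) 0.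
  by rewrite v0 (enorm_eq0 v0) -(scale0r 0) dotpZr mul0r mulr0.
(* Expanding this square gives [2 * |u||v| * (|u||v| - <u,v>) >= 0], from which the positive factor
   is cancelled. *)
have := dotp_ge0 (enorm v *: u - enorm u *: v).
rewrite !(dotpDl, dotpDr, dotpNl, dotpNr, dotpZl, dotpZr) -!sqr_enorm (dotpC v u).
have : 0 < enorm u * enorm v
  by rewrite mulr_gt0// lt_neqAle eq_sym ?u0 ?v0 enorm_ge0.
move=> uv_gt0 H; rewrite -subr_ge0 -(pmulr_rge0 _ uv_gt0).
by nra.
Qed.

Lemma enormD (R : realType) (d : nat) (u v : 'rV[R]_d) :
  enorm (u + v) <= enorm u + enorm v.
Proof.
rewrite -ler_sqr ?nnegrE ?addr_ge0 ?enorm_ge0// sqrrD !sqr_enorm.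
rewrite !(dotpDl, dotpDr) (dotpC v u).
by have := dotp_le_enorm u v; lra.
Qed.

Lemma enormZ (R : realType) (d : nat) (a : R) (u : 'rV[R]_d) :
  enorm (a *: u) = `|a| * enorm u.
Proof.
by rewrite /enorm dotpZl dotpZr mulrA -expr2 sqrtrM ?sqr_ge0// sqrtr_sqr.
Qed.

Lemma enormN (R : realType) (d : nat) (u : 'rV[R]_d) : enorm (- u) = enorm u.
Proof. by rewrite -scaleN1r enormZ normrN1 mul1r. Qed.

Lemma enormB (R : realType) (d : nat) (u v : 'rV[R]_d) :
  enorm (u - v) <= enorm u + enorm v.
Proof. by rewrite (le_trans (enormD _ _))// enormN. Qed.

Lemma enorm_le_norm (R : realType) (d : nat) (u : 'rV[R]_d) :
  enorm u <= Num.sqrt (d%:R * `|u| ^+ 2).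
Proof.
rewrite ler_sqrt ?mulr_ge0 ?sqr_ge0//.
have -> : d%:R * `|u| ^+ 2 = \sum_(i < d) `|u| ^+ 2.
  by rewrite sumr_const card_ord mulr_natl.
apply: ler_sum => i _; rewrite -expr2 -real_normK ?num_real//.
rewrite ler_sqr ?nnegrE ?normr_ge0//.
rewrite [leRHS]/Num.norm /= mx_normrE.
exact: (le_bigmax _ (fun ij : 'I_1 * 'I_d => `|u ij.1 ij.2|) (ord0, i)).
Qed.

Lemma compact_enorm_bounded (R : realType) (d : nat) (A : set 'rV[R]_d) :
  compact A -> exists2 M : R, 0 <= M & forall u, A u -> enorm u <= M.
Proof.
move=> /compact_bounded [B [_ HB]].
(* Every real above [B] bounds the sup norm on [A]; [|B| + 1] is one that is also nonnegative. *)
exists (Num.sqrt (d%:R * (`|B| + 1) ^+ 2)); first exact: sqrtr_ge0.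
move=> u Au; apply: le_trans (enorm_le_norm u) _.
rewrite ler_sqrt ?mulr_ge0 ?sqr_ge0// ler_wpM2l//.
rewrite ler_sqr ?nnegrE ?addr_ge0//.
by apply: (HB (`|B| + 1)) => //; rewrite (le_lt_trans (ler_norm B))// ltrDl.
Qed.

(** * Gradient inequalities from convexity and smoothness *)

Lemma derive_grad (R : realType) (d : nat) (h : 'rV[R]_d -> R)
    (x v : 'rV[R]_d) :
  differentiable h x -> 'D_v h x = dotp (grad h x) v.
Proof.
move=> dh; rewrite deriveE// {1}(row_sum_delta v) linear_sum /dotp.
by apply: eq_bigr => i _; rewrite linearZ mxE deriveE// mulrC.
Qed.

(** By convexity the difference quotient at [x] along [y - x] is at most [h y - h x] for
    [0 < t <= 1]; let [t] tend to 0 from the right. *)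
Lemma convex_grad_le (R : realType) (d : nat) (h : 'rV[R]_d -> R)
    (x y : 'rV[R]_d) :
  convex_function setT h -> differentiable h x ->
  dotp (grad h x) (y - x) <= h y - h x.
Proof.
move=> hc dh; rewrite -derive_grad//.
have cv : (fun t => t^-1 *: ((h \o shift x) (t *: (y - x)) - h x)) @ 0^'+ -->
    'D_(y - x) h x.
  by apply: cvg_dnbhs_at_right; exact: diff_derivable.
rewrite -(cvg_lim _ cv)//; apply: limr_le.
  by apply/cvg_ex; exists ('D_(y - x) h x).
near=> t.
have t0 : 0 < t by near: t; exact: nbhs_right_gt.
have t1 : t <= 1 by near: t; exact: nbhs_right_le.
have := hc (Itv01 (ltW t0) t1) y x (in_setT _) (in_setT _).
have -> : conv (Itv01 (ltW t0) t1) (y : convex_lmodType _) x = t *: (y - x) + x.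
  by rewrite /conv /= /unstable.onem scalerBr scalerBl scale1r addrA addrAC.
rewrite convRE /= /unstable.onem => H.
rewrite [leLHS]mulrC ler_pdivrMr//; lra.
Unshelve. all: by end_near. Qed.

(** Plays the role of the gradient of [average f]; the termwise form reduces each bound to one on a
    single component. *)
Definition avg_grad (R : realType) (d m : nat) (f : 'I_m -> 'rV[R]_d -> R)
    (x : 'rV[R]_d) : 'rV[R]_d :=
  m%:R^-1 *: \sum_(i < m) grad (f i) x.

Lemma average_grad_le (R : realType) (d m : nat) (f : 'I_m -> 'rV[R]_d -> R)
    (x y : 'rV[R]_d) :
  (forall i, convex_function setT (f i)) ->
  (forall i, differentiable (f i) x) ->
  dotp (avg_grad f x) (y - x) <= average f y - average f x.
Proof.
move=> f_convex df; rewrite /average /avg_grad dotpZl dotp_suml -mulrBr -sumrB.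
apply: ler_wpM2l; first by rewrite invr_ge0.
by apply: ler_sum => i _; exact: convex_grad_le.
Qed.

Lemma average_le (R : realType) (m : nat) (F : 'I_m -> R) (c : R) :
  (0 < m)%N -> (forall i, F i <= c) -> m%:R^-1 * \sum_(i < m) F i <= c.
Proof.
move=> m_gt0 Fc; rewrite mulrC ler_pdivrMr ?ltr0n//.
have -> : c * m%:R = \sum_(i < m) c by rewrite sumr_const card_ord mulr_natr.
exact: ler_sum.
Qed.

(** Cauchy-Schwarz and the Lipschitz bound; no sign is assumed for [L], and [|L|] keeps the bound
    monotone in [B]. *)
Lemma smooth_dotp_le (R : realType) (d : nat) (L B : R) (h : 'rV[R]_d -> R)
    (x y v : 'rV[R]_d) :
  smooth L h -> enorm (x - y) <= B ->
  dotp (grad h x - grad h y) v <= `|L| * B * enorm v.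
Proof.
move=> [_ Lh] xyB; apply: le_trans (dotp_le_enorm _ _) _.
apply: ler_wpM2r; first exact: enorm_ge0.
apply: le_trans (Lh x y) _; apply: le_trans (ler_wpM2l _ xyB) => //.
by apply: ler_wpM2r; [exact: enorm_ge0 | exact: ler_norm].
Qed.

Lemma avg_grad_dotp_le (R : realType) (d m : nat) (L : R)
    (f : 'I_m -> 'rV[R]_d -> R) (x y v : 'rV[R]_d) :
  (0 < m)%N -> (forall i, smooth L (f i)) ->
  dotp (avg_grad f x - avg_grad f y) v <= `|L| * enorm (x - y) * enorm v.
Proof.
move=> m_gt0 f_smooth; rewrite /avg_grad -scalerBr -sumrB dotpZl dotp_suml.
by apply: average_le => // i; exact: smooth_dotp_le.
Qed.

(* Convexity at [y] makes the usual descent lemma a consequence of the gradient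
   inequality, with constant [L] instead of [L / 2]. *)
Lemma average_descent (R : realType) (d m : nat) (L : R)
    (f : 'I_m -> 'rV[R]_d -> R) (x y : 'rV[R]_d) :
  (0 < m)%N -> (forall i, convex_function setT (f i)) ->
  (forall i, smooth L (f i)) ->
  average f y - average f x <=
    dotp (avg_grad f x) (y - x) + `|L| * enorm (y - x) ^+ 2.
Proof.
move=> m_gt0 f_convex f_smooth.
have := average_grad_le x f_convex (fun i => (f_smooth i).1 y).
have := avg_grad_dotp_le y x (y - x) m_gt0 f_smooth.
rewrite -(opprB y x) dotpNr dotpDl dotpNl expr2 mulrA; lra.
Qed.

(** * The aggregated gradient as a sliding window *)

Lemma cyclic_indexB (m : nat) (m_gt0 : (0 < m)%N) (k : nat) :
  (m <= k)%N -> cyclic_index m_gt0 (k - m) = cyclic_index m_gt0 k.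
Proof. by move=> mk; apply: val_inj; rewrite /= -[in RHS](subnK mk) modnDr. Qed.

(** One move of a window of length [m]: the oldest term [b m.-1] leaves, the new term [a 0]
    enters. *)
Lemma sum_shift (V : zmodType) (a b : nat -> V) (m : nat) :
  (0 < m)%N -> (forall j, a j.+1 = b j) ->
  \sum_(0 <= j < m) a j = \sum_(0 <= j < m) b j - b m.-1 + a 0%N.
Proof.
case: m => // m _ ab; rewrite big_nat_recl// big_nat_recr//= addrK addrC.
by congr (_ + _); apply: eq_bigr.
Qed.

(** Here [j] is the age of a gradient. The guard [j <= k] removes the ages reaching before the
    start, where [k - j] would be truncated to 0. *)
Lemma ifw_gradE (R : realType) (d m : nat) (m_gt0 : (0 < m)%N)
    (Omega : set 'rV[R]_d) (f : 'I_m -> 'rV[R]_d -> R) (alpha : nat -> R)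
    (x D w : nat -> 'rV[R]_d) (run : incremental_FW m_gt0 Omega f alpha x D w)
    (k : nat) :
  D k = m%:R^-1 *: \sum_(0 <= j < m)
    if (j <= k)%N then grad (f (cyclic_index m_gt0 (k - j))) (x (k - j)%N) else 0.
Proof.
have mN0 : m%:R != 0 :> R by rewrite pnatr_eq0 -lt0n.
elim: k => [|k IHk].
  rewrite (ifw_grad run) /= m_gt0 scaler0 oppr0 !add0r; congr (_ *: _).
  by rewrite big_ltn// big_nat_cond big1 ?addr0// => -[].
rewrite (ifw_grad run) (_ : Defs.prev D k.+1 = D k)// {}IHk.
rewrite scalerA mulfV// scale1r; congr (_ *: _).
pose T i j := if (j <= i)%N
  then grad (f (cyclic_index m_gt0 (i - j))) (x (i - j)%N) else 0.
rewrite -/(T k) -/(T k.+1).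
rewrite (@sum_shift _ (T k.+1) (T k) _ m_gt0)//.
rewrite /T subn0; congr (_ - _ + _).
(* The leaving term has age [m - 1]: it is 0 while [k + 1 < m], and otherwise the gradient at
   [x (k + 1 - m)] of the component now refreshed. *)
rewrite (_ : (m.-1 <= k)%N = ~~ (k.+1 < m)%N); last by rewrite -leqNgt; lia.
case: ltnP => //= mk; rewrite (_ : k - m.-1 = k.+1 - m)%N; last lia.
by rewrite cyclic_indexB.
Qed.

(** The [m] consecutive indices [k - j], not truncated since [m <= k + 1], meet every residue modulo
    [m] once, so the window only permutes the components. *)
Lemma avg_grad_window (R : realType) (d m : nat) (m_gt0 : (0 < m)%N)
    (f : 'I_m -> 'rV[R]_d -> R) (x : 'rV[R]_d) (k : nat) :
  (m <= k.+1)%N ->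
  avg_grad f x =
    m%:R^-1 *: \sum_(j < m) grad (f (cyclic_index m_gt0 (k - j))) x.
Proof.
move=> mk; congr (_ *: _).
rewrite (reindex_inj (h := fun j : 'I_m => cyclic_index m_gt0 (k - j)))//.
move=> i j /(congr1 val) /= ij; apply: val_inj => /=.
have [im jm] : (i < m)%N /\ (j < m)%N by [].
(* Adding [i + j] to both sides of [k - i = k - j] modulo [m] removes the subtractions. *)
have : (k + j = k + i %[mod m])%N.
  rewrite (_ : k + j = k - i + (i + j))%N; last lia.
  rewrite (_ : k + i = k - j + (i + j))%N; last lia.
  by rewrite -modnDml ij modnDml.
by move/eqP; rewrite eqn_modDl !modn_small// => /eqP.
Qed.

(** Both vectors average over the same window, so smoothness applies term by term; [B] bounds the
    drift of the iterates within the window. *)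
Lemma ifw_grad_error (R : realType) (d m : nat) (m_gt0 : (0 < m)%N) (L B : R)
    (Omega : set 'rV[R]_d) (f : 'I_m -> 'rV[R]_d -> R) (alpha : nat -> R)
    (x D w : nat -> 'rV[R]_d) (run : incremental_FW m_gt0 Omega f alpha x D w)
    (k : nat) (v : 'rV[R]_d) :
  (forall i, smooth L (f i)) -> (m <= k.+1)%N ->
  (forall j, (j < m)%N -> enorm (x (k - j)%N - x k) <= B) ->
  dotp (D k - avg_grad f (x k)) v <= `|L| * B * enorm v.
Proof.
move=> f_smooth mk xB; rewrite (ifw_gradE run) (avg_grad_window m_gt0 f _ mk).
rewrite -scalerBr big_mkord -sumrB dotpZl dotp_suml.
apply: average_le => // j.
have -> : (j <= k)%N by have := ltn_ord j; lia.
by apply: smooth_dotp_le => //; exact: xB.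
Qed.

(** * Step lengths and boundedness of the iterates *)

Lemma ifw_stepE (R : realType) (d m : nat) (m_gt0 : (0 < m)%N)
    (Omega : set 'rV[R]_d) (f : 'I_m -> 'rV[R]_d -> R) (alpha : nat -> R)
    (x D w : nat -> 'rV[R]_d) (run : incremental_FW m_gt0 Omega f alpha x D w)
    (k : nat) :
  x k.+1 - x k = alpha k *: (w k - x k).
Proof.
rewrite (ifw_step run) scalerBl scale1r scalerBr addrAC (addrAC (x k)) subrr.
by rewrite add0r addrC.
Qed.

Lemma ifw_step_le (R : realType) (d m : nat) (m_gt0 : (0 < m)%N) (B : R)
    (Omega : set 'rV[R]_d) (f : 'I_m -> 'rV[R]_d -> R) (alpha : nat -> R)
    (x D w : nat -> 'rV[R]_d) (run : incremental_FW m_gt0 Omega f alpha x D w)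
    (k : nat) :
  0 <= alpha k -> enorm (w k - x k) <= B ->
  enorm (x k.+1 - x k) <= alpha k * B.
Proof.
move=> a0 wB; by rewrite (ifw_stepE run) enormZ ger0_norm// ler_wpM2l.
Qed.

Lemma enorm_delay (R : realType) (d : nat) (x : nat -> 'rV[R]_d) (c : R)
    (i n : nat) :
  (forall l, (i <= l < i + n)%N -> enorm (x l.+1 - x l) <= c) ->
  enorm (x i - x (i + n)%N) <= c *+ n.
Proof.
elim: n => [|n IHn] xc.
  by rewrite addn0 subrr mulr0n -(scale0r 0) enormZ normr0 mul0r.
have -> : x i - x (i + n.+1)%N =
    (x i - x (i + n)%N) - (x (i + n).+1 - x (i + n)%N).
  by rewrite addnS opprB addrA subrK.
apply: le_trans (enormB _ _) _; rewrite mulrSr; apply: lerD.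
  by apply: IHn => l lin; apply: xc; lia.
by apply: xc; lia.
Qed.

(** From index 1 on, each iterate is a convex combination of the previous one and a point of norm at
    most [M], so a ball is preserved. As [alpha 0] may exceed 1, [x 1] is counted separately in
    [B]. *)
Lemma bounded_averages (R : realType) (d : nat) (M : R) (alpha : nat -> R)
    (x w : nat -> 'rV[R]_d) :
  (forall k, 0 <= alpha k) -> (forall k, (1 <= k)%N -> alpha k <= 1) ->
  (forall k, enorm (w k) <= M) ->
  (forall k, x k.+1 = (1 - alpha k) *: x k + alpha k *: w k) ->
  exists2 B : R, 0 <= B & forall k, enorm (x k) <= B.
Proof.
move=> a0 a1 wM xS; pose B := enorm (x 0%N) + enorm (x 1%N) + M.
have M0 : 0 <= M by apply: le_trans (wM 0%N); exact: enorm_ge0.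
have x0 := enorm_ge0 (x 0%N); have x1 := enorm_ge0 (x 1%N).
exists B => [|k]; first by rewrite !addr_ge0.
case: k => [|k]; first by rewrite /B; lra.
elim: k => [|k IHk]; first by rewrite /B; lra.
rewrite xS; apply: le_trans (enormD _ _) _; rewrite !enormZ.
have := a0 k.+1; have := a1 k.+1 isT => ale1 age0.
rewrite !ger0_norm ?subr_ge0//.
have wB : enorm (w k.+1) <= B by apply: le_trans (wM _) _; rewrite /B; lra.
have := ler_wpM2l age0 wB.
have : (1 - alpha k.+1) * enorm (x k.+1) <= (1 - alpha k.+1) * B.
  by rewrite ler_wpM2l ?subr_ge0.
lra.
Qed.

(** * From the one-step recurrence to the rate *)

Lemma rate_of_recurrence (R : realType) (h : nat -> R) (K : R) (N : nat) :
  0 <= K -> (1 <= N)%N ->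
  (forall k, (N <= k)%N ->
    h k.+1 <= (1 - 2 / k.+1%:R) * h k + K / k.+1%:R ^+ 2) ->
  exists C : R, forall k, (1 <= k)%N -> h k <= C / k%:R.
Proof.
(* The sum dominates [k * |h k|] for each [k <= N], before the recurrence takes over; the term [K]
   gives [K <= C], which closes the induction. *)
move=> K0 N1 hS; exists (K + \sum_(k < N.+1) k%:R * `|h k|).
set C := K + _.
have KC : K <= C by rewrite lerDl sumr_ge0// => k _; rewrite mulr_ge0.
have small k : (1 <= k <= N)%N -> h k <= C / k%:R.
  move=> /andP[k1 kN]; rewrite ler_pdivlMr ?ltr0n//.
  have kN1 : (k < N.+1)%N by [].
  rewrite /C (bigD1 (Ordinal kN1))//= addrCA.
  apply: le_trans (_ : k%:R * `|h k| <= _).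
    by rewrite mulrC ler_wpM2l ?ler_norm.
  by rewrite lerDl addr_ge0// sumr_ge0// => i _; rewrite mulr_ge0.
elim=> [//|k IHk] _.
have [kN|Nk] := ltnP k N; first by apply: small; lia.
have k1 : (1 <= k)%N by lia.
apply: le_trans (hS k Nk) _; have {}IHk := IHk k1.
have k0 : 0 < k%:R :> R by rewrite ltr0n.
have k1R : 1 <= k%:R :> R by rewrite ler1n.
have a0 : 0 <= 1 - 2 / k.+1%:R :> R.
  by rewrite subr_ge0 ler_pdivrMr ?ltr0n// mul1r ler_nat.
have := ler_wpM2l a0 IHk; move: KC k0 k1R; rewrite -(natr1 k); clearbody C.
move: (k%:R : R) => t KC t0 t1 H.
apply: le_trans (lerD H (lexx _)) _; rewrite -subr_ge0.
have -> : C / (t + 1) - ((1 - 2 / (t + 1)) * (C / t) + K / (t + 1) ^+ 2) =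
    (C * (t + 1) - K * t) / (t * (t + 1) ^+ 2).
  by field; rewrite !lt0r_neq0//; lra.
rewrite divr_ge0// ?mulr_ge0 ?exprn_ge0; nra.
Qed.

(** Holds because [k + 1 <= l + m <= m * (l + 1)]: within the window, earlier step sizes exceed the
    current one by a factor at most [m]. *)
Lemma alpha_window (R : realType) (m k l : nat) :
  (0 < m)%N -> (k < l + m)%N -> (l <= k)%N ->
  2 / l.+1%:R <= 2 * m%:R / k.+1%:R :> R.
Proof.
move=> m_gt0 klm lk; rewrite ler_pdivrMr ?ltr0n// mulrAC ler_pdivlMr ?ltr0n//.
rewrite -mulrA ler_pM2l// -natrM ler_nat; nia.
Qed.

Unset Implicit Arguments.

Theorem theorem3 (R : realType) (d m : nat) (m_gt0 : (0 < m)%N) (L : R)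
    (Omega : set 'rV[R]_d)
    (Omega_neq0 : Omega !=set0)
    (Omega_compact : compact Omega)
    (Omega_convex : convex_set Omega)
    (f : 'I_m -> 'rV[R]_d -> R)
    (f_convex : forall i, convex_function setT (f i))
    (f_smooth : forall i, smooth L (f i))
    (xstar : 'rV[R]_d)
    (xstar_min : argmin Omega (average f) xstar)
    (x D w : nat -> 'rV[R]_d)
    (run : incremental_FW m_gt0 Omega f (fun k => 2 / (k.+1)%:R) x D w) :
  exists C : R, forall k : nat, (1 <= k)%N ->
    average f (x k) - average f xstar <= C / k%:R.
Proof.
pose alpha k : R := 2 / k.+1%:R.
have [M M0 OmegaM] := compact_enorm_bounded Omega_compact.
have a0 k : 0 <= alpha k by rewrite divr_ge0.
have a1 k : (1 <= k)%N -> alpha k <= 1.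
  by move=> k1; rewrite ler_pdivrMr ?ltr0n// mul1r ler_nat.
have wM k : enorm (w k) <= M by apply: OmegaM; case: (ifw_lmo run k).
have [X X0 xX] := bounded_averages a0 a1 wM (ifw_step run).
(* [B] bounds the distance from any point of [Omega] to any iterate, including those outside
   [Omega]. *)
pose B := M + X; have B0 : 0 <= B by rewrite addr_ge0.
have diam u k : Omega u -> enorm (u - x k) <= B.
  by move=> Ou; apply: le_trans (enormB _ _) _; apply: lerD; [exact: OmegaM|].
have wB k : enorm (w k - x k) <= B by apply: diam; case: (ifw_lmo run k).
pose E : R := `|L| * (2 * m%:R ^+ 2 * B).
have L0 : 0 <= `|L| by [].
(* [4 * E * B] collects [alpha k] times two gradient errors [E * B / (k + 1)], and [4 * |L| * B ^ 2]
   is the quadratic descent term with [alpha k = 2 / (k + 1)]. *)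
apply: (@rate_of_recurrence _ (fun k => average f (x k) - average f xstar)
  (4 * E * B + 4 * `|L| * B ^+ 2) m) => // [|k mk].
  by rewrite /E; have := ler0n R m => m0; rewrite addr_ge0 ?mulr_ge0 ?exprn_ge0.
have delay j : (j < m)%N ->
    enorm (x (k - j)%N - x k) <= 2 * m%:R ^+ 2 * B / k.+1%:R.
  (* [c] bounds each of the [j < m] steps from [x (k - j)] to [x k]. *)
  move=> jm; pose c : R := 2 * m%:R / k.+1%:R * B.
  have c0 : 0 <= c by rewrite mulr_ge0 ?divr_ge0 ?mulr_ge0.
  have : enorm (x (k - j)%N - x (k - j + j)%N) <= c *+ j.
    apply: enorm_delay => l ljk; apply: le_trans (ifw_step_le run (a0 l) (wB l)) _.
    by rewrite ler_wpM2r// alpha_window//; lia.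
  rewrite subnK; last lia; move=> /le_trans; apply.
  rewrite (_ : 2 * _ * B / _ = c * m%:R); last by rewrite /c; ring.
  by rewrite -(mulr_natr c j) ler_wpM2l// ler_nat ltnW.
have error v : enorm v <= B ->
    `|dotp (D k - avg_grad f (x k)) v| <= E / k.+1%:R * B.
  move=> vB.
  have e0 u : enorm u <= B -> dotp (D k - avg_grad f (x k)) u <= E / k.+1%:R * B.
    move=> uB; apply: le_trans (ifw_grad_error run u f_smooth _ delay) _; first lia.
    rewrite mulrA -/E; apply: ler_wpM2l => //.
    by rewrite !mulr_ge0// ?invr_ge0// exprn_ge0.
  (* The lower bound is the upper bound applied to [- v]. *)
  by rewrite ler_norml e0// lerNl -dotpNr e0// enormN.
have := average_descent (x k) (x k.+1) m_gt0 f_convex f_smooth.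
have step2 : enorm (x k.+1 - x k) ^+ 2 <= (alpha k * B) ^+ 2.
  by rewrite ler_sqr ?nnegrE ?enorm_ge0 ?mulr_ge0 ?(ifw_step_le run (a0 k) (wB k)).
have := ler_wpM2l L0 step2; rewrite (ifw_stepE run k) -/(alpha k) dotpZr.
have lmo : dotp (D k) (w k) <= dotp (D k) xstar.
  by case: (ifw_lmo run k) => _; apply; case: xstar_min.
have xsB : enorm (xstar - x k) <= B by apply: diam; case: xstar_min.
have grad_xs := average_grad_le xstar f_convex (fun i => (f_smooth i).1 (x k)).
have := error _ xsB; have := error _ (wB k); rewrite !ler_norml.
move=> /andP[errw _] /andP[_ errxs].
(* Pass from the true gradient to [D k], replace [w k] by [xstar] by minimality, and pass back: each
   passage costs one error, whence the factor 2. *)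
have inner : dotp (avg_grad f (x k)) (w k - x k) <=
    average f xstar - average f (x k) + 2 * (E / k.+1%:R * B).
  move: errw errxs grad_xs lmo; move: (E / k.+1%:R * B) => e.
  rewrite !(dotpDl, dotpDr, dotpNl, dotpNr); lra.
have := ler_wpM2l (a0 k) inner.
set q := dotp _ _; set e := enorm _ => H1 H2 H3.
have -> : (4 * E * B + 4 * `|L| * B ^+ 2) / k.+1%:R ^+ 2 =
    alpha k * (2 * (E / k.+1%:R * B)) + `|L| * (alpha k * B) ^+ 2.
  have : k.+1%:R != 0 :> R by rewrite pnatr_eq0.
  by rewrite /alpha; move: k.+1%:R => t t0; field.
move: H1 H2 H3; move: (E / k.+1%:R * B) (`|L| * (alpha k * B) ^+ 2) => a b.
move: (alpha k) => c; lra.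
Qed.
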